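(* Let $F$ be a field with $\operatorname{char} F\ne 2$. Every Rota--Baxter operator of nonzero weight on the Grassmann algebra $\mathrm{Gr}_2$ of the plane over $F$ is splitting.
   Context: $\mathrm{Gr}_2$ is the Grassmann (exterior) algebra of the two-dimensional vector space $\mathrm{span}\{e_1,e_2\}$ over $F$; it has linear basis $1,e_1,e_2,e_1\wedge e_2$. A linear operator $R\colon A\to A$ on an algebra $A$ over $F$ is a Rota--Baxter operator of weight $\Delta\in F$ if $R(x)R(y)=R(R(x)y+xR(y)+\Delta xy)$ for all $x,y\in A$. A Rota--Baxter operator $R$ of weight $\Delta$ on $A$ is called splitting if there are subalgebras $A_1,A_2$ of $A$ (possibly zero) such that $A=A_1\oplus A_2$ as vector spaces and $R(x_1+x_2)=-\Delta x_2$ for all $x_1\in A_1$, $x_2\in A_2$. *)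

(* Defs.v *)
From HB Require Import structures.
From mathcomp Require Import all_boot all_order all_algebra all_field.
From mathcomp Require Import ssrAC.
From mathcomp Require Import ring.

Set Implicit Arguments.
Unset Strict Implicit.
Unset Printing Implicit Defensive.

Import GRing.Theory.
Local Open Scope ring_scope.

(* Coordinates are taken in the basis 1, e1, e2, e1 /\ e2, in this order.     *)
Definition gr2 (F : fieldType) : Type := 'rV[F]_4.

HB.instance Definition _ (F : fieldType) := Vector.on (gr2 F).

Section Gr2.

Variable F : fieldType.
Implicit Types x y z : gr2 F.

Definition gr2_mk (a b c d : F) : gr2 F := \row_(i < 4) [:: a; b; c; d]`_i.

Definition gr2_coord x (i : nat) : F := (x : 'rV[F]_4) 0 (inord i).

Definition gr2_one : gr2 F := gr2_mk 1 0 0 0.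
Definition gr2_e1 : gr2 F := gr2_mk 0 1 0 0.
Definition gr2_e2 : gr2 F := gr2_mk 0 0 1 0.
Definition gr2_e12 : gr2 F := gr2_mk 0 0 0 1.

(* The wedge product: the bilinear extension of e1 /\ e1 = e2 /\ e2 = 0 and   *)
(* e2 /\ e1 = - (e1 /\ e2).                                                   *)
Definition gr2_mul x y : gr2 F :=
  let: (x0, x1, x2, x3) :=
    (gr2_coord x 0, gr2_coord x 1, gr2_coord x 2, gr2_coord x 3) in
  let: (y0, y1, y2, y3) :=
    (gr2_coord y 0, gr2_coord y 1, gr2_coord y 2, gr2_coord y 3) in
  gr2_mk (x0 * y0)
         (x0 * y1 + x1 * y0)
         (x0 * y2 + x2 * y0)
         (x0 * y3 + x3 * y0 + x1 * y2 - x2 * y1).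

Lemma gr2_coord_mk a b c d i :
  (i < 4)%N -> gr2_coord (gr2_mk a b c d) i = [:: a; b; c; d]`_i.
Proof. by move=> lt_i4; rewrite /gr2_coord mxE inordK. Qed.

Lemma gr2_eqP x y :
  [/\ gr2_coord x 0 = gr2_coord y 0, gr2_coord x 1 = gr2_coord y 1,
      gr2_coord x 2 = gr2_coord y 2 & gr2_coord x 3 = gr2_coord y 3] -> x = y.
Proof.
rewrite /gr2_coord => -[h0 h1 h2 h3]; apply/rowP => i.
by rewrite -(inord_val i); case: i => [[|[|[|[|//]]]] ?].
Qed.

Lemma gr2_coordD x y i : gr2_coord (x + y) i = gr2_coord x i + gr2_coord y i.
Proof. by rewrite /gr2_coord mxE. Qed.

Lemma gr2_coordZ a x i : gr2_coord (a *: x) i = a * gr2_coord x i.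
Proof. by rewrite /gr2_coord mxE. Qed.

Lemma gr2_coord0 i : gr2_coord 0 i = 0.
Proof. by rewrite /gr2_coord mxE. Qed.

Lemma gr2_coordN x i : gr2_coord (- x) i = - gr2_coord x i.
Proof. by rewrite /gr2_coord mxE. Qed.

Local Ltac gr2_solve :=
  apply: gr2_eqP; rewrite /gr2_mul /gr2_one /gr2_e1 /gr2_e2 /gr2_e12;
  rewrite ?(gr2_coordD, gr2_coordZ, gr2_coord0, gr2_coordN, gr2_coord_mk) //=;
  split; ring.

Fact gr2_mulA : associative gr2_mul.
Proof. by move=> x y z; gr2_solve. Qed.

Fact gr2_mul1 : left_id gr2_one gr2_mul.
Proof. by move=> x; gr2_solve. Qed.

Fact gr2_mulr1 : right_id gr2_one gr2_mul.
Proof. by move=> x; gr2_solve. Qed.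

Fact gr2_mulDl : left_distributive gr2_mul +%R.
Proof. by move=> x y z; gr2_solve. Qed.

Fact gr2_mulDr : right_distributive gr2_mul +%R.
Proof. by move=> x y z; gr2_solve. Qed.

Fact gr2_one_neq0 : gr2_one != 0.
Proof.
apply/eqP => /(congr1 (gr2_coord^~ 0)).
by rewrite /gr2_one gr2_coord_mk // gr2_coord0 /=; apply/eqP/oner_neq0.
Qed.

HB.instance Definition _ := GRing.Zmodule_isNzRing.Build (gr2 F)
  gr2_mulA gr2_mul1 gr2_mulr1 gr2_mulDl gr2_mulDr gr2_one_neq0.

Fact gr2_scaleAl (a : F) x y : a *: (x * y) = (a *: x) * y.
Proof. by rewrite /GRing.mul /=; gr2_solve. Qed.

HB.instance Definition _ :=
  GRing.Lmodule_isLalgebra.Build F (gr2 F) gr2_scaleAl.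

Fact gr2_scaleAr (a : F) x y : a *: (x * y) = x * (a *: y).
Proof. by rewrite /GRing.mul /=; gr2_solve. Qed.

HB.instance Definition _ :=
  GRing.Lalgebra_isAlgebra.Build F (gr2 F) gr2_scaleAr.

HB.instance Definition _ := Algebra_isFalgebra.Build F (gr2 F).

Lemma gr2_mulE x y : x * y = gr2_mul x y. Proof. by []. Qed.

Lemma gr2_oneE : 1 = gr2_one. Proof. by []. Qed.

Lemma gr2_e12E : gr2_e12 = gr2_e1 * gr2_e2.
Proof. by rewrite gr2_mulE; gr2_solve. Qed.

Lemma gr2_decomp x :
  x = gr2_coord x 0 *: 1 + gr2_coord x 1 *: gr2_e1 + gr2_coord x 2 *: gr2_e2
      + gr2_coord x 3 *: (gr2_e1 * gr2_e2).
Proof. by rewrite -gr2_e12E gr2_oneE; gr2_solve. Qed.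

Lemma gr2_wedge_sq a b : (a *: gr2_e1 + b *: gr2_e2) ^+ 2 = 0.
Proof. by rewrite expr2 gr2_mulE; gr2_solve. Qed.

(* The universal property of the exterior algebra of the plane.               *)
Lemma gr2_univ (A : algType F) (u v : A) :
    (forall a b, (a *: u + b *: v) ^+ 2 = 0) ->
  exists f : {lrmorphism gr2 F -> A}, f gr2_e1 = u /\ f gr2_e2 = v.
Proof.
move=> sq0.
have uu : u * u = 0 by rewrite -(sq0 1 0) scale1r scale0r addr0 expr2.
have vv : v * v = 0 by rewrite -(sq0 0 1) scale1r scale0r add0r expr2.
have vu : v * u = - (u * v).
  apply/eqP; rewrite -addr_eq0 addrC; apply/eqP; rewrite -(sq0 1 1).
  by rewrite !scale1r expr2 mulrDl !mulrDr uu vv add0r addr0.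
pose f x : A := gr2_coord x 0 *: 1 + gr2_coord x 1 *: u + gr2_coord x 2 *: v
                + gr2_coord x 3 *: (u * v).
have f_lin : linear f.
  move=> a x y; rewrite /f !(gr2_coordD, gr2_coordZ) !scalerDl -!scalerA.
  by rewrite !scalerDr !addrA (ACl (1*3*5*7*2*4*6*8)).
have uuv : u * (u * v) = 0 by rewrite mulrA uu mul0r.
have vuv : v * (u * v) = 0 by rewrite mulrA vu mulNr -mulrA vv mulr0 oppr0.
have uvu : u * v * u = 0 by rewrite -mulrA vu mulrN uuv oppr0.
have uvv : u * v * v = 0 by rewrite -mulrA vv mulr0.
have uvuv : u * v * (u * v) = 0 by rewrite -mulrA vuv mulr0.
have f_mul : monoid_morphism f.
  split=> [|x y]; first by rewrite /f gr2_oneE !gr2_coord_mk //= scale1r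
    !scale0r !addr0.
  rewrite /f gr2_mulE /gr2_mul !gr2_coord_mk //=.
  rewrite !(mulrDl, mulrDr) -!(scalerAl, scalerAr) !scalerA !(mul1r, mulr1).
  rewrite uu vv uuv vuv uvu uvv uvuv vu !scaler0 !addr0 !scalerDl !scaleNr.
  by rewrite scalerN !addrA [RHS](ACl (1*2*5*3*7*4*9*6*8)).
pose fL := GRing.isLinear.Build F (gr2 F) A *:%R f f_lin.
pose fM := GRing.isMonoidMorphism.Build (gr2 F) A f f_mul.
pose g : {lrmorphism gr2 F -> A} := HB.pack f fL fM.
exists g; rewrite ![g _]/(f _) /f /gr2_e1 /gr2_e2 !gr2_coord_mk //=.
by rewrite !(scale0r, scale1r, add0r, addr0).
Qed.

Lemma gr2_univ_uniq (A : algType F) (f g : {lrmorphism gr2 F -> A}) :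
  f gr2_e1 = g gr2_e1 -> f gr2_e2 = g gr2_e2 -> f =1 g.
Proof.
move=> fg1 fg2 x; rewrite (gr2_decomp x).
by rewrite !linearD !linearZ /= !rmorphM !rmorph1 /= fg1 fg2.
Qed.

End Gr2.

Definition rota_baxter (F : fieldType) (A : algType F) (D : F) (R : A -> A) :=
  forall x y : A, R x * R y = R (R x * y + x * R y + D *: (x * y)).

(* Not {aspace A}: the summands below may be zero or have no unit.            *)
Definition subalgebra (F : fieldType) (A : falgType F) (U : {vspace A}) :=
  {in U &, forall x y : A, x * y \in U}.

Definition splitting (F : fieldType) (A : falgType F) (D : F) (R : A -> A) :=
  exists A1 A2 : {vspace A},
    [/\ subalgebra A1, subalgebra A2,
        directv (A1 + A2)%VS, (A1 + A2)%VS = fullv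
      & forall x1 x2 : A, x1 \in A1 -> x2 \in A2 -> R (x1 + x2) = - D *: x2].

(* Main.v *)
Require Import Defs.
From HB Require Import structures.
From mathcomp Require Import all_boot all_order all_algebra all_field.

Import GRing.Theory.
Local Open Scope ring_scope.

(** Rescaling, let [P] have weight -1 and put [Q = 1 - P], again of weight -1;
    [R] is splitting as soon as [P] is idempotent.  The map [P x |-> - Q x] is a
    ring isomorphism from [Im P / ker Q] onto [Im Q / ker P].  As the algebra is
    local and [Im P + Im Q] is everything, one of the two subalgebras, say
    [Im P], contains a unit, hence contains 1.  If [Im Q] also contained 1,
    comparing identities would give [P x = 1] with [x] in [ker P]; so [Im Q] is
    nil, its quotient is nil and unital, hence zero, and [P Q = 0]. *)

Section WeightMinusOne.

Variables (F : fieldType) (A : algType F).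
Implicit Type P : {linear A -> A}.

Lemma rota_baxter_scale (D : F) P : D != 0 -> rota_baxter D P ->
  rota_baxter (-1) (- D^-1 \*: P).
Proof.
move=> D0; have DK : D * (- D^-1 * - D^-1) = -1 * - D^-1.
  by rewrite mulrA [D * _]mulrN mulfV.
move=> RB x y; rewrite /= -!(scalerAl, scalerAr) scalerA RB.
by rewrite !linearD !linearZ /= !scalerA DK.
Qed.

(** With [p = P x] and [q = P y], this form of the argument merely changes sign when [P] is replaced
    by [1 - P]. *)
Lemma rota_baxter_argE (x y p q : A) :
  p * y + x * q + -1 *: (x * y) = p * q - (x - p) * (y - q).
Proof.
by rewrite scaleN1r -addrA -mulrBr -mulrN opprB mulrBl addrCA -mulrBr subKr addrC.
Qed.

Lemma rota_baxterN1E P : rota_baxter (-1) P ->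
  forall x y, P x * P y = P (P x * P y - (x - P x) * (y - P y)).
Proof.
by move=> RB x y; rewrite {1}RB rota_baxter_argE.
Qed.

Lemma rota_baxter_compl P : rota_baxter (-1) P ->
  rota_baxter (-1) (idfun \- P).
Proof.
move=> RB x y /=; rewrite rota_baxter_argE !subKr -[- P (_ - _)]linearN opprB.
by rewrite -(rota_baxterN1E _ RB) subrK.
Qed.

Lemma rota_baxter_ker_ideal P : rota_baxter (-1) P ->
  forall u i, P i = 0 -> P ((u - P u) * i) = 0.
Proof.
move=> RB u i Pi; have := rota_baxterN1E _ RB u i.
by rewrite Pi mulr0 subr0 sub0r linearN => /eqP; rewrite eq_sym oppr_eq0 => /eqP.
Qed.

(** The isomorphism sends [1 = P x] to [1 - x], which is thus a left identity of the image of
    [1 - P] modulo the kernel of [P]. *)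
Lemma rota_baxter_preim1_mul P x : rota_baxter (-1) P -> P x = 1 ->
  forall y, P (x * (y - P y)) = 0.
Proof.
move=> RB Px y; have := rota_baxterN1E _ RB x y.
rewrite Px !mul1r => E.
have -> : x * (y - P y) = y - (P y - (x - 1) * (y - P y)).
  by rewrite opprB addrCA mulrBl mul1r subrK.
by rewrite linearB -E subrr.
Qed.

Lemma rota_baxter_compl_preim1 P x y : rota_baxter (-1) P -> P x = 1 ->
  y - P y != 1.
Proof.
move=> RB Px; apply/eqP => Qy; have := rota_baxter_preim1_mul _ _ RB Px y.
by rewrite Qy mulr1 Px => /eqP; rewrite oner_eq0.
Qed.

(** The kernel of [P] contains [x * (y - P y)] and is stable under left multiplication by [x - P x];
    since [x] is invertible, it also contains [y - P y]. *)
Lemma rota_baxter_preim1_idem P x : rota_baxter (-1) P -> P x = 1 ->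
  (x - P x) ^+ 2 = 0 -> forall y, P (P y) = P y.
Proof.
move=> RB Px; rewrite Px => sq0 y.
have xQ := rota_baxter_preim1_mul _ _ RB Px y.
have nxQ := rota_baxter_ker_ideal _ RB x _ xQ.
(* With [n = x - 1] of square zero, [1 - n] is the inverse of [x]. *)
have nx : (x - 1) * x = x - 1.
  by rewrite -{2}(subrK 1 x) mulrDr mulr1 -expr2 sq0 add0r.
have E : y - P y = x * (y - P y) - (x - P x) * (x * (y - P y)).
  by rewrite Px [(x - 1) * _]mulrA nx mulrBl mul1r subKr.
by apply/esym/eqP; rewrite -subr_eq0 -linearB E linearB xQ nxQ subr0.
Qed.

End WeightMinusOne.

Section Grassmann.

Variable F : fieldType.
Implicit Type P : {linear gr2 F -> gr2 F}.

Lemma gr2_coord0_sq (x : gr2 F) : gr2_coord x 0 = 0 -> x ^+ 2 = 0.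
Proof.
move=> x0; rewrite expr2 gr2_mulE; apply: gr2_eqP.
rewrite /gr2_mul !gr2_coord_mk // !gr2_coord0 x0 /=.
by rewrite !mul0r !mulr0 !addr0 add0r mulrC subrr.
Qed.

(** Expanding [(P u - a) ^+ 2 = 0] writes [1] as a polynomial in [P u] without constant term, and
    the image of [P] is closed under products. *)
Lemma rota_baxter_gr2_preim1 P u : rota_baxter (-1) P ->
  gr2_coord (P u) 0 != 0 -> exists x, P x = 1.
Proof.
move=> RB; set a := gr2_coord _ _ => a0.
have sq0 : (P u - a%:A) ^+ 2 = 0.
  apply: gr2_coord0_sq.
  by rewrite gr2_coordD gr2_coordN gr2_coordZ gr2_coord_mk //= mulr1 subrr.
have E : 1 = a ^- 2 *: (a *: P u *+ 2 - P u * P u).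
  have : a ^+ 2 *: 1 = a *: P u *+ 2 - P u * P u :> gr2 F.
    move: sq0; rewrite expr2 mulrBl !mulrBr -!(scalerAl, scalerAr) mul1r mulr1.
    move=> /eqP; rewrite subr_eq0 subr_eq scalerA -expr2 => /eqP ->.
    by rewrite opprD opprB addrA mulr2n addrA -addrA -opprD addrC addKr mulr1.
  by move=> <-; rewrite scalerA mulVf ?scale1r // expf_neq0.
(* A preimage of [P u * P u] is read off the Rota-Baxter identity. *)
exists (a ^- 2 *: (a *: u *+ 2 - (P u * u + u * P u + -1 *: (u * u)))).
by rewrite [RHS]E linearZ linearB linearMn linearZ /= -RB.
Qed.

Lemma rota_baxter_gr2_preim1_idem P x : rota_baxter (-1) P -> P x = 1 ->
  forall y, P (P y) = P y.
Proof.
move=> RB Px; apply: rota_baxter_preim1_idem (Px) _ => //.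
(* A nonzero scalar part of [x - P x] would put [1] in both images. *)
apply: gr2_coord0_sq; apply/eqP; apply: contraT => Qx0.
have [z /eqP] := rota_baxter_gr2_preim1 _ _ (rota_baxter_compl _ _ _ RB) Qx0.
by rewrite (negPf (rota_baxter_compl_preim1 _ _ _ _ _ RB Px)).
Qed.

Lemma rota_baxter_gr2_idem P : rota_baxter (-1) P -> forall y, P (P y) = P y.
Proof.
move=> RB y; case: (eqVneq (gr2_coord (P 1) 0) 0) => [P1|P1].
- have RBQ := rota_baxter_compl _ _ _ RB.
  have Q1 : gr2_coord ((idfun \- P) 1) 0 != 0.
    by rewrite /= gr2_coordD gr2_coordN P1 subr0 gr2_coord_mk ?oner_neq0.
  have [x Qx] := rota_baxter_gr2_preim1 _ _ RBQ Q1.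
  have /= := rota_baxter_gr2_preim1_idem _ _ RBQ Qx y.
  (* Idempotency of [1 - P] says that [P] kills [y - P y]. *)
  by rewrite -[RHS]subr0 linearB => /addrI/oppr_inj/subr0_eq.
- by have [x Px] := rota_baxter_gr2_preim1 _ _ RB P1;
    apply: rota_baxter_gr2_preim1_idem Px y.
Qed.

End Grassmann.

(** The summands are the eigenspaces of [R] for [0] and [- D]. *)
Lemma splitting_of_idem (F : fieldType) (A : falgType F) (D : F)
    (R : {linear A -> A}) : D != 0 -> rota_baxter D R ->
  (forall y, R (R y) = - D *: R y) -> splitting D R.
Proof.
move=> D0 RB RR.
pose S : {linear A -> A} := R \+ D \*: idfun.
have inK x : (x \in lker (linfun R)) = (R x == 0) by rewrite memv_ker lfunE.
have inS x : (x \in lker (linfun S)) = (R x == - D *: x).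
  by rewrite memv_ker lfunE /= addr_eq0 scaleNr.
exists (lker (linfun R)), (lker (linfun S)); split.
- move=> x y; rewrite !inK => /eqP Rx /eqP Ry; have := RB x y.
  rewrite Rx Ry !mul0r mulr0 !add0r linearZ => /eqP.
  by rewrite eq_sym scaler_eq0 (negPf D0).
- move=> x y; rewrite !inS => /eqP Rx /eqP Ry; have := RB x y.
  rewrite Rx Ry -!(scalerAl, scalerAr) -addrA -scalerDl addNr scale0r addr0.
  by rewrite [R _]linearZ /= => /scalerI <-; rewrite ?oppr_eq0.
- apply/directv_addP/eqP; rewrite -subv0; apply/subvP => x.
  rewrite memv_cap inK inS => /andP[/eqP -> ].
  by rewrite eq_sym scaler_eq0 oppr_eq0 (negPf D0) memv0.
- apply/eqP; rewrite eqEsubv subvf; apply/subvP => x _.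
  (* The component of [x] in the second eigenspace is [- D^-1 *: R x]. *)
  rewrite -(addrK (D^-1 *: R x) x); apply: memv_add.
    by rewrite inK linearD linearZ /= RR scalerA mulrN mulVf // scaleN1r subrr.
  by rewrite inS linearN linearZ /= RR scalerN !scalerA mulrC.
- move=> x1 x2; rewrite inK inS => /eqP R1 /eqP R2.
  by rewrite linearD R1 R2 add0r.
Qed.

Theorem theorem4 (F : fieldType) (charF : 2%N \notin [pchar F])
    (D : F) (D_neq0 : D != 0) (R : {linear gr2 F -> gr2 F})
    (RB_R : @rota_baxter F (gr2 F) D R) :
  @splitting F (gr2 F) D R.
Proof.
apply: splitting_of_idem => // y.
(* Idempotency of [- D^-1 \*: R], with the outer scalar cancelled. *)
have E : R (- D^-1 *: R y) = R y.
  apply: (@scalerI _ _ (- D^-1)); first by rewrite oppr_eq0 invr_eq0.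
  exact: rota_baxter_gr2_idem _ (rota_baxter_scale _ _ _ _ D_neq0 RB_R) y.
by rewrite -[in RHS]E [R (_ *: _)]linearZ /= scalerA mulrNN mulfV // scale1r.
Qed.
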